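(* Let $(X,\mathcal{B},\mu,T)$ be an ergodic measure-preserving dynamical system on a non-atomic probability space. Let $\alpha>2$, let $f\ge 0$ satisfy $\int_X f\,(\log^+ f)^{2\alpha}\,d\mu<\infty$ (i.e. $f\in L(\log L)^{2\alpha}$), and let $g\ge 0$ with $g\in L^1(\mu)$. Then $$R^*(f,g)(x)=\sup_{n\ge1}\frac{f(T^nx)\,g(T^{2n}x)}{n}$$ is finite for $\mu$-almost every $x\in X$.
   Context: $\log^+ t=\max\{\log t,0\}$ for $t>0$ (and $0$ for $t=0$). *)

(* Defs.v *)
From HB Require Import structures.
From mathcomp Require Import all_boot all_order all_algebra.
From mathcomp Require Import all_classical all_reals all_analysis.
Set Implicit Arguments. Unset Strict Implicit. Unset Printing Implicit Defensive.
Import Order.TTheory GRing.Theory Num.Theory.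
Local Open Scope classical_set_scope.
Local Open Scope ring_scope.

Definition logp {R : realType} (t : R) : R :=
  if 0 < t then Num.max (ln t) 0 else 0.

Section defs.
Context {d : measure_display} {X : measurableType d} {R : realType}.

Definition measure_preserving (P : probability X R) (T : X -> X) : Prop :=
  measurable_fun setT T /\
  forall A : set X, measurable A -> P (T @^-1` A) = P A.

Definition ergodic (P : probability X R) (T : X -> X) : Prop :=
  forall A : set X, measurable A -> T @^-1` A = A ->
    P A = 0%E \/ P A = 1%E.

Definition nonatomic (P : probability X R) : Prop :=
  forall A : set X, measurable A -> (0 < P A)%E ->
    exists B : set X, [/\ measurable B, B `<=` A, (0 < P B)%E & (P B < P A)%E].
End defs.

(* Main.v *)
Require Import Defs.
From HB Require Import structures.
From mathcomp Require Import all_boot all_order all_algebra.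
From mathcomp Require Import all_classical all_reals all_analysis.
From mathcomp Require Import measurable_realfun zify ring lra.
Set Implicit Arguments. Unset Strict Implicit. Unset Printing Implicit Defensive.
Import Order.TTheory GRing.Theory Num.Theory.
Local Open Scope classical_set_scope.
Local Open Scope ring_scope.

(* With [L = logp f], the weight [w = expR L * (1 + L) ^ 2] is integrable.  By
   the maximal inequality, outside a set of measure [O(1 / c)] all its forward
   averages are at most [c].  Fix [y = T^{2N} x] and look back: the times [n]
   with [lam n < f (T^{2N-n} x) * g y] whose starting point [T^{2N-2n} x] has
   averages at most [c] number at most [C c g y / lam], because the weight limits
   how often each level of [L] is visited.  Integrating in [x], shifting each
   term by invariance of the measure, and letting [lam], then [c], go to
   infinity gives the result.  Looking back from [T^{2N} x] replaces the
   inverse of [T], which need not exist. *)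

Lemma sum_inv_squares_le2 (R : realFieldType) (K : nat) :
  \sum_(k < K) ((k.+1)%:R ^+ 2)^-1 <= 2 :> R.
Proof.
case: K => [|K]; first by rewrite big_ord0.
(* The sharper bound telescopes: [(a + 1)^-2 <= a^-1 - (a + 1)^-1]. *)
suff : \sum_(k < K.+1) ((k.+1)%:R ^+ 2)^-1 <= 2 - (K.+1)%:R^-1 :> R.
  by move=> /le_trans; apply; rewrite gerBl invr_ge0.
elim: K => [|K IH]; first by rewrite big_ord1 /= expr1n invr1; lra.
rewrite big_ord_recr /=; apply: le_trans (lerD IH (lexx _)) _.
have a0 : 0 < (K.+1)%:R :> R by [].
have -> : (K.+2)%:R = (K.+1)%:R + 1 :> R by rewrite natr1.
move: (K.+1)%:R a0 => a a0.
have -> : 2 - (a + 1)^-1 = 2 - a^-1 + (a * (a + 1))^-1.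
  by field; apply/andP; split; lra.
by rewrite lerD2l lef_pV2 ?posrE; nra.
Qed.

Lemma measurable_lt_set (d : measure_display) (X : measurableType d)
    (R : realType) (u v : X -> R) :
  measurable_fun setT u -> measurable_fun setT v ->
  measurable [set x | u x < v x].
Proof.
move=> mu mv; rewrite -[[set _ | _]]setTI.
exact: (measurable_fun_ltr mu mv measurableT (Y := [set true])).
Qed.

(** * The positive logarithm and the weight *)

Section logp_lemmas.
Context {R : realType}.
Implicit Type t : R.

Lemma logp_ge0 t : 0 <= logp t.
Proof. by rewrite /logp; case: ifP => // _; rewrite le_max lexx orbT. Qed.

Lemma expR_logp_ge t : t <= expR (logp t).
Proof.
rewrite /logp; case: (ltP 0 t) => t0; last exact: le_trans t0 (expR_ge0 _).
by rewrite -[leLHS]lnK// ler_expR le_max lexx.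
Qed.

Lemma measurable_logp : measurable_fun setT (@logp R).
Proof.
apply: measurable_fun_if => //.
- by apply: measurable_fun_ltr; [exact: measurable_cst|exact: measurable_id].
- apply: measurable_funTS; apply: measurable_maxr; last exact: measurable_cst.
  exact: measurable_ln.
Qed.

(** [expR l] stands for the size of [f] at logarithmic level [l]; the factor [(1 + l) ^+ 2] makes
    the bounds for the separate levels summable. *)
Definition level_weight (l : R) := expR l * (1 + l) ^+ 2.

Lemma level_weight_ge0 l : 0 <= level_weight l.
Proof. by rewrite mulr_ge0 ?expR_ge0 ?sqr_ge0. Qed.

Lemma measurable_level_weight : measurable_fun setT level_weight.
Proof.
apply: measurable_funM; first exact: measurable_expR.
apply: measurable_funX; apply: measurable_funD; first exact: measurable_cst.
exact: measurable_id.
Qed.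

Lemma level_weight_logp_le (a t : R) : 2 <= a -> 0 <= t ->
  level_weight (logp t) <= expR 1 * 4 + 4 * (t * logp t `^ a).
Proof.
move=> a2 t0; have l0 := logp_ge0 t.
have [l1|l1] := leP (logp t) 1.
  have : level_weight (logp t) <= expR 1 * 4.
    apply: ler_pM; [exact: expR_ge0|exact: sqr_ge0|by rewrite ler_expR|nra].
  move=> /le_trans; apply; rewrite lerDl mulr_ge0// mulr_ge0// powR_ge0//.
have expl : expR (logp t) = t.
  move: l1; rewrite /logp; case: (ltP 0 t) => [t1|_]; last by rewrite ltr10.
  rewrite lt_max [1 < 0]ltr10 orbF => l1.
  by rewrite (max_idPl _) ?lnK// ltW// (lt_trans _ l1).
have : level_weight (logp t) <= 4 * (t * logp t `^ a).
  rewrite /level_weight expl [leRHS]mulrCA ler_wpM2l//.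
  apply: (@le_trans _ _ (4 * logp t ^+ 2)); first nra.
  rewrite ler_pM2l// -powR_mulrn// ler_powR//; lra.
by move=> /le_trans; apply; rewrite lerDr mulr_ge0// expR_ge0.
Qed.
End logp_lemmas.

(** * Counting visits along one orbit *)

(* If [n] is the last index of [Q] with [L n] in [[k, k + 1)], the first
   hypothesis on [Q] gives at most [2 c n / (expR k * k.+1 ^ 2)] such indices and
   the second gives [n <= expR k.+1 * s]; the resulting bound is summable in [k]. *)
Lemma count_le (R : realType) (L : nat -> R) (Q : pred nat) (c s : R) (N : nat) :
  (forall n, 0 <= L n) -> 0 <= c -> 0 <= s ->
  (forall n, Q n ->
    \sum_(1 <= j < (2 * n).+1) level_weight (L j) <= c * (2 * n)%:R) ->
  (forall n, Q n -> n%:R <= expR (L n) * s) ->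
  \sum_(1 <= n < N) (Q n)%:R <= 4 * expR 1 * c * s.
Proof.
move=> L0 c0 s0 Qsum Qn.
pose lev n := Num.truncn (L n).
have levP n : (lev n)%:R <= L n < (lev n).+1%:R by exact: truncn_itv.
have weight n : expR (lev n)%:R * (lev n).+1%:R ^+ 2
    <= level_weight (L n).
  have /andP[h _] := levP n.
  apply: ler_pM; [exact: expR_ge0|exact: exprn_ge0|by rewrite ler_expR|].
  have := ler0n R (lev n).
  by rewrite -natr1 => h0; rewrite lerXn2r ?nnegrE; lra.
have level k : (\sum_(1 <= n < N) (Q n && (lev n == k))%:R)
    * (expR k%:R * k.+1%:R ^+ 2) <= 2 * c * (expR k.+1%:R * s).
  elim: N => [|N IH].
    rewrite big_geq// mul0r; apply: mulr_ge0; first lra.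
    by apply: mulr_ge0 => //; exact: expR_ge0.
  case: N IH => [|N] IH.
    rewrite big_geq// mul0r; apply: mulr_ge0; first lra.
    by apply: mulr_ge0 => //; exact: expR_ge0.
  have [/andP[QN /eqP levN]|nQN] := boolP (Q N.+1 && (lev N.+1 == k)); last first.
    by rewrite big_nat_recr//= (negbTE nQN) addr0.
  have h1 : (\sum_(1 <= n < N.+2) (Q n && (lev n == k))%:R)
      * (expR k%:R * k.+1%:R ^+ 2) <=
      \sum_(1 <= j < (2 * N.+1).+1) level_weight (L j).
    rewrite (@big_cat_nat _ _ _ N.+2 1 (2 * N.+1).+1)//=; last first.
      by rewrite ltnS leq_pmull.
    rewrite mulr_suml -[leLHS]addr0; apply: lerD.
      apply: ler_sum => j _; case: andP => [[_ /eqP <-]|_].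
        by rewrite mul1r weight.
      by rewrite mul0r level_weight_ge0.
    by apply: sumr_ge0 => j _; rewrite level_weight_ge0.
  apply: le_trans h1 (le_trans (Qsum _ QN) _).
  rewrite natrM mulrCA mulrA; apply: ler_wpM2l; first lra.
  apply: le_trans (Qn _ QN) _; apply: ler_wpM2r => //.
  by rewrite ler_expR -levN ltW//; have /andP[] := levP N.+1.
(* [expR k.+1] divided by [expR k] leaves [expR 1], so the dependence on [k] is only through the
   inverse square. *)
have {}level k : \sum_(1 <= n < N) (Q n && (lev n == k))%:R
    <= 2 * expR 1 * c * s * (k.+1%:R ^+ 2)^-1.
  have w0 : 0 < k.+1%:R ^+ 2 :> R by rewrite exprn_gt0.
  rewrite ler_pdivlMr// -(ler_pM2l (expR_gt0 k%:R)).
  have := level k; rewrite -natr1 expRD.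
  move: (expR 1) (expR _) (\sum_(_ <= _ < _) _) => e1 ek S h.
  by apply: le_trans (le_trans h _); [rewrite mulrCA; lra|nra].
(* [K] exceeds every level met before [N], so each visit is counted for exactly one [k < K]. *)
pose K := (\max_(n < N) lev n).+1.
have -> : \sum_(1 <= n < N) (Q n)%:R =
    \sum_(k < K) \sum_(1 <= n < N) (Q n && (lev n == k))%:R :> R.
  rewrite exchange_big/=; apply: eq_big_nat => n /andP[_ nN].
  have nK : (lev n < K)%N by rewrite ltnS (leq_bigmax (Ordinal nN)).
  rewrite (bigD1 (Ordinal nK))//= eqxx andbT big1 ?addr0// => k.
  by rewrite eq_sym -val_eqE /= => /negbTE ->; rewrite andbF.
have /le_trans -> // : \sum_(k < K) \sum_(1 <= n < N) (Q n && (lev n == k))%:R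
    <= \sum_(k < K) 2 * expR 1 * c * s * (k.+1%:R ^+ 2)^-1 :> R.
  by apply: ler_sum => k _.
rewrite -mulr_sumr.
have h : 0 <= 2 * expR 1 * c * s by rewrite !mulr_ge0// expR_ge0.
apply: le_trans (ler_wpM2l h (sum_inv_squares_le2 _ _)) _; nra.
Qed.

(** * Invariance and the maximal inequality *)

Section preserving.
Context {d : measure_display} {X : measurableType d} {R : realType}.
Context (P : probability X R) (T : X -> X) (hT : measure_preserving P T).

Lemma measure_preserving_iter n : measure_preserving P (iter n T).
Proof.
elim: n => [|n [mn pn]]; first by split; [exact: measurable_id|].
have [mT pT] := hT; split; first exact: measurableT_comp.
move=> A mA; rewrite -(pT A mA); apply: pn.
by rewrite -[_ @^-1` _]setTI; exact: mT.
Qed.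

Lemma ge0_integral_preserving (u : X -> \bar R) :
  measurable_fun setT u -> (forall x, 0 <= u x)%E ->
  (\int[P]_x u (T x) = \int[P]_x u x)%E.
Proof.
move=> mu u0; have [mT pT] := hT.
rewrite -[LHS](ge0_integral_pushforward mT P measurableT mu)//.
by apply: eq_measure_integral => A mA _; exact: pT.
Qed.

(* The maximum over [m <= N] of the Birkhoff sums
   [\sum_(k < m) h (iter k T x)], starting from the empty sum. *)
Fixpoint max_birkhoff (h : X -> R) N : X -> R :=
  if N is N'.+1 then fun x => Num.max 0 (h x + max_birkhoff h N' (T x))
  else fun=> 0.

Lemma max_birkhoff_ge0 h N x : 0 <= max_birkhoff h N x.
Proof. by case: N => //= N; rewrite le_max lexx. Qed.

Lemma max_birkhoff_nd h N x : max_birkhoff h N x <= max_birkhoff h N.+1 x.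
Proof.
elim: N x => [|N IH] x; first exact: max_birkhoff_ge0.
by rewrite /= ge_max !le_max lexx/= lerD2l IH orbT.
Qed.

Lemma birkhoff_le_max h N x :
  \sum_(k < N) h (iter k T x) <= max_birkhoff h N x.
Proof.
elim: N x => [|N IH] x; first by rewrite big_ord0.
rewrite big_ord_recl /= le_max; apply/orP; right.
rewrite lerD2l; apply: le_trans (IH (T x)).
by under eq_bigr do rewrite -iterS iterSr.
Qed.

Lemma measurable_max_birkhoff h N : measurable_fun setT h ->
  measurable_fun setT (max_birkhoff h N).
Proof.
move=> mh; elim: N => [|N IH] /=; first exact: measurable_cst.
apply: measurable_maxr; first exact: measurable_cst.
apply: measurable_funD => //; apply: measurableT_comp => //.
by case: hT.
Qed.

(* Garsia: pointwise [c * 1_{M N > 0} + M N <= phi + M N \o T]; integrate and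
   cancel the integral of [M N]. *)
Lemma maximal_inequality (phi : X -> R) (c : R) :
  measurable_fun setT phi -> (forall x, 0 <= phi x) -> 0 < c ->
  (\int[P]_x (phi x)%:E < +oo)%E ->
  exists H, [/\ measurable H, (c%:E * P H <= \int[P]_x (phi x)%:E)%E &
    forall x m, ~ H x -> \sum_(k < m) phi (iter k T x) <= c * m%:R].
Proof.
move=> mphi phi0 c0 ifin.
(* An average of [phi] exceeds [c] exactly when the Birkhoff sum of [h] is positive. *)
pose h x := phi x - c; pose M := max_birkhoff h.
have mh : measurable_fun setT h by exact: measurable_funB.
have mM N : measurable_fun setT (M N) by exact: measurable_max_birkhoff.
have mME N : measurable_fun setT (EFin \o M N) by exact/measurable_EFinP.
have M0 N x : (0 <= (M N x)%:E)%E by rewrite lee_fin max_birkhoff_ge0.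
pose F N := [set x | 0 < M N x].
have mF N : measurable (F N).
  by apply: measurable_lt_set => //; exact: measurable_cst.
have shift N : (\int[P]_x (phi x)%:E + \int[P]_x (M N x)%:E =
    \int[P]_x ((phi x)%:E + (M N (T x))%:E))%E.
  rewrite ge0_integralD//.
  - congr (_ + _)%E; apply/esym.
    exact: (ge0_integral_preserving (mME N) (M0 N)).
  - by move=> x _; rewrite lee_fin.
  - exact/measurable_EFinP.
  - by apply: (measurableT_comp (mME N)); case: hT.
have bound N : (c%:E * P (F N) <= \int[P]_x (phi x)%:E)%E.
  case: N => [|N].
    have -> : F 0%N = set0 by apply/seteqP; split=> x //=; rewrite /F/= ltxx.
    by rewrite measure0 mule0; apply: integral_ge0 => x _; rewrite lee_fin.
  have mIF : measurable_fun setT (fun x => (c * \1_(F N.+1) x)%:E).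
    by apply/measurable_EFinP/measurable_funM => //; exact: measurable_indic.
  have IF0 x : (0 <= (c * \1_(F N.+1) x)%:E)%E.
    by rewrite lee_fin mulr_ge0// ltW.
  (* Finiteness permits the cancellation below; it propagates through [M K.+1 <= phi + M K \o T]. *)
  have Mfin K : (\int[P]_x (M K x)%:E < +oo)%E.
    elim: K => [|K IHK]; first by rewrite integral0 ltry.
    apply: (@le_lt_trans _ _ (\int[P]_x (phi x)%:E + \int[P]_x (M K x)%:E)%E).
      rewrite shift; apply: ge0_le_integral => //.
      - exact: (mME K.+1).
      - apply: emeasurable_funD; first exact/measurable_EFinP.
        by apply: (measurableT_comp (mME K)); case: hT.
      - move=> x _; rewrite -EFinD lee_fin /M /= ge_max addr_ge0 ?max_birkhoff_ge0//.
        by rewrite /h lerD2r gerBl ltW.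
    exact: lte_add_pinfty.
  rewrite -(@leeD2rE _ (\int[P]_x (M N.+1 x)%:E)%E); last first.
    by rewrite ge0_fin_numE// integral_ge0.
  rewrite shift -[X in P X]setIT -integral_indic// -ge0_integralZl_EFin//; first last.
  - exact: ltW.
  - by apply/measurable_EFinP; exact: measurable_indic.
  rewrite -ge0_integralD//; first last.
  - exact: (mME N.+1).
  - by move=> x _; exact: IF0.
  apply: ge0_le_integral => //.
  - by move=> x _; apply: adde_ge0 => //; exact: IF0.
  - exact: (emeasurable_funD mIF (mME N.+1)).
  - apply: emeasurable_funD; first exact/measurable_EFinP.
    by apply: (measurableT_comp (mME _)); case: hT.
  - move=> x _; rewrite -EFinM -!EFinD lee_fin indicE.
    (* On [F N.+1] the maximum is its second argument, so [c + M N.+1 x = phi x + M N (T x)]; off it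
       the left side vanishes. *)
    have [|nF] := boolP (x \in F N.+1).
      rewrite inE /F /= /M /= mulr1 lt_max ltxx/= => /ltW/max_idPr ->.
      rewrite /h addrA [c + _]addrC subrK lerD2l.
      exact: (max_birkhoff_nd h N (T x)).
    have -> : M N.+1 x = 0.
      by apply/eqP; rewrite eq_le max_birkhoff_ge0 andbT leNgt; apply: contra nF;
        rewrite inE.
    by rewrite mulr0 addr0 addr_ge0// max_birkhoff_ge0.
have mH : measurable (\bigcup_N F N) by exact: bigcup_measurable.
exists (\bigcup_N F N); split => //.
- have cvgF : P (F N) @[N --> \oo] --> P (\bigcup_N F N).
    apply: nondecreasing_cvg_mu => //; apply/nondecreasing_seqP => N.
    by apply/subsetPset => x; rewrite /F /= => /lt_le_trans; apply;
      exact: max_birkhoff_nd.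
  have {}cvgF : (c%:E * P (F N))%E @[N --> \oo] --> (c%:E * P (\bigcup_N F N))%E.
    exact: cvgeZl.
  rewrite -(cvg_lim _ cvgF)//; apply: lime_le; first by apply/cvg_ex; eexists; exact: cvgF.
  by apply: nearW => N.
- move=> x m nHx.
  have Mx0 : M m x <= 0.
    by rewrite leNgt; apply/negP => Mx; apply: nHx; exists m.
  have := le_trans (birkhoff_le_max h m x) Mx0.
  rewrite /h sumrB subr_le0 => /le_trans; apply.
  by rewrite sumr_const card_ord mulr_natr.
Qed.
End preserving.

(** * Counting integrated over the space *)

(* The [n]-th set is pulled back by [T^{2N-2n}], so that [g] is evaluated at the
   same point [T^{2N} x] for all [n]. *)
Lemma visits_le (d : measure_display) (X : measurableType d) (R : realType)
    (P : probability X R) (T : X -> X) (f g : X -> R) (H : set X) (c lam : R) (N : nat) :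
  measure_preserving P T ->
  measurable_fun setT f -> measurable_fun setT g -> measurable H ->
  (forall x, 0 <= g x) -> 0 < c -> 0 < lam ->
  (forall x m, ~ H x ->
    \sum_(k < m) level_weight (logp (f (iter k T x))) <= c * m%:R) ->
  (\sum_(1 <= n < N) P (~` H `&`
      [set x | (lam * n%:R < f (iter n T x) * g (iter (2 * n) T x))%R])
   <= (4 * expR 1 * c / lam)%:E * \int[P]_x (g x)%:E)%E.
Proof.
move=> hT mf mg mH g0 c0 lam0 Hsum.
have mT n : measurable_fun setT (iter n T) by have [] := measure_preserving_iter hT n.
pose D n := ~` H `&` [set x | lam * n%:R < f (iter n T x) * g (iter (2 * n) T x)].
have mD n : measurable (D n).
  apply: measurableI; first exact: measurableC.
  apply: measurable_lt_set; first exact: measurable_cst.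
  by apply: measurable_funM; exact: measurableT_comp.
pose E n := iter (2 * N - 2 * n) T @^-1` D n.
have mE n : measurable (E n) by rewrite -[E n]setTI; exact: mT.
have -> : (\sum_(1 <= n < N) P (D n) = \sum_(1 <= n < N) \int[P]_x (\1_(E n) x)%:E)%E.
  apply: eq_bigr => n _; rewrite integral_indic// setIT.
  by have [_ h] := measure_preserving_iter hT (2 * N - 2 * n); rewrite -(h _ (mD n)).
have mg2 : measurable_fun setT (EFin \o (g \o iter (2 * N) T)).
  by apply/measurable_EFinP; exact: measurableT_comp.
have -> : (\int[P]_x (g x)%:E = \int[P]_x (g (iter (2 * N) T x))%:E)%E.
  apply/esym/(ge0_integral_preserving (measure_preserving_iter hT (2 * N)) (u := EFin \o g)).
  - exact/measurable_EFinP.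
  - by move=> x; rewrite lee_fin.
have C0 : 0 <= 4 * expR 1 * c / lam.
  by rewrite !mulr_ge0 ?expR_ge0 ?invr_ge0 ?ltW.
rewrite -ge0_integral_sum//; last first.
  by move=> n; apply/measurable_EFinP; exact: measurable_indic.
rewrite -ge0_integralZl_EFin//; last by move=> x _; rewrite lee_fin.
apply: ge0_le_integral => //.
- by move=> x _; apply: sume_ge0 => n _; rewrite lee_fin.
- apply: emeasurable_sum => n.
  by apply/measurable_EFinP; exact: measurable_indic.
- exact: measurable_funeM mg2.
move=> x _; rewrite -EFinM sumEFin lee_fin.
pose L j := logp (f (iter (2 * N - j) T x)).
(* The condition [n < N] keeps the truncated subtraction [2 * N - 2 * n] exact. *)
pose Q n := (n < N)%N && (x \in E n).
have -> : \sum_(1 <= n < N) \1_(E n) x = \sum_(1 <= n < N) (Q n)%:R :> R.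
  by apply: eq_big_nat => n /andP[_ nN]; rewrite /Q nN indicE.
rewrite [leRHS](_ : _ = 4 * expR 1 * c * (g (iter (2 * N) T x) / lam)); last first.
  by rewrite [in RHS]mulrA mulrAC.
have shift n : (n < N)%N -> forall k, (k <= 2 * n)%N ->
    iter k T (iter (2 * N - 2 * n) T x) = iter (2 * N - (2 * n - k)) T x.
  by move=> nN k kn; rewrite -iterD; congr (iter _ T x); lia.
apply: (count_le (L := L) (Q := Q)).
- by move=> n; exact: logp_ge0.
- exact: ltW.
- by rewrite divr_ge0// ltW.
- move=> n /andP[nN]; rewrite inE => -[nH _].
  apply: le_trans (Hsum _ (2 * n)%N nH).
  (* Reversing the order turns the forward sum of length [2 * n] from the pulled-back point into the
     sum of [L] over [1 <= j <= 2 * n]. *)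
  rewrite big_add1 /= big_mkord (reindex_inj rev_ord_inj)/=.
  apply: ler_sum => k _; rewrite shift// /L; last exact: ltnW.
  by rewrite subnSK.
- move=> n /andP[nN]; rewrite inE => -[_ /= h].
  rewrite mulrA ler_pdivlMr// mulrC; apply: le_trans (ltW h) _.
  rewrite !shift// ?leq_pmull// subnn subn0 ler_wpM2r//.
  rewrite (_ : (2 * n - n = n)%N); last lia.
  exact: expR_logp_ge.
Qed.

(** * Finiteness almost everywhere *)

Unset Implicit Arguments.

Theorem theorem2 (d : measure_display) (X : measurableType d) (R : realType)
  (P : probability X R) (T : X -> X)
  (hT : measure_preserving P T) (herg : ergodic P T) (hna : nonatomic P)
  (alpha : R) (halpha : 2 < alpha)
  (f g : X -> R)
  (mf : measurable_fun setT f) (f0 : forall x, 0 <= f x)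
  (hf : (\int[P]_x ((f x * (logp (f x)) `^ (2 * alpha))%:E) < +oo)%E)
  (mg : measurable_fun setT g) (g0 : forall x, 0 <= g x)
  (ig : P.-integrable setT (fun x => (g x)%:E)) :
  {ae P, forall x, exists M : R, forall n : nat, (1 <= n)%N ->
      f (iter n T x) * g (iter (2 * n) T x) / n%:R <= M}.
Proof.
have mT n : measurable_fun setT (iter n T).
  by have [] := measure_preserving_iter hT n.
have mfg n : measurable_fun setT (fun x => f (iter n T x) * g (iter (2 * n) T x)).
  by apply: measurable_funM; exact: measurableT_comp.
(* The points with infinite supremum, as a countable combination of measurable sets; [n.+1] encodes
   [1 <= n]. *)
pose F := \bigcap_i \bigcup_n
  [set x | i%:R < f (iter n.+1 T x) * g (iter (2 * n.+1) T x) / n.+1%:R].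
have mF : measurable F.
  apply: bigcap_measurableType => i _; apply: bigcup_measurable => n _.
  apply: measurable_lt_set; first exact: measurable_cst.
  by apply: measurable_funM => //; exact: measurable_cst.
pose phi x := level_weight (logp (f x)).
have phi0 x : 0 <= phi x by exact: level_weight_ge0.
have mlogf : measurable_fun setT (fun x => logp (f x)).
  exact: measurableT_comp measurable_logp mf.
have mphi : measurable_fun setT phi.
  exact: measurableT_comp measurable_level_weight mlogf.
have phifin : (\int[P]_x (phi x)%:E < +oo)%E.
  pose u x := f x * logp (f x) `^ (2 * alpha).
  have u0 x : (0 <= (u x)%:E)%E by rewrite lee_fin mulr_ge0// powR_ge0.
  have mu : measurable_fun setT (fun x => (u x)%:E).
    apply/measurable_EFinP/measurable_funM => //.
    exact: measurableT_comp (measurable_powR _) mlogf.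
  have e0 : 0 <= expR 1 * 4 :> R by rewrite mulr_ge0// expR_ge0.
  apply: (@le_lt_trans _ _ (\int[P]_x ((expR 1 * 4)%:E + 4%:E * (u x)%:E))%E).
    apply: ge0_le_integral => //.
    - by move=> x _; rewrite lee_fin.
    - exact/measurable_EFinP.
    - by apply: emeasurable_funD => //; exact: measurable_funeM.
    - move=> x _; rewrite -EFinM -EFinD lee_fin.
      by apply: level_weight_logp_le => //; lra.
  rewrite ge0_integralD//; last 2 first.
  - by move=> x _; rewrite mule_ge0.
  - exact: measurable_funeM.
  rewrite ge0_integralZl_EFin// integral_cst//.
  apply: lte_add_pinfty; apply: lte_mul_pinfty => //.
  exact: le_lt_trans (probability_le1 P measurableT) (ltry _).
have [A [A0 intphi]] : exists A : R, 0 <= A /\ (\int[P]_x (phi x)%:E = A%:E)%E.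
  have h0 : (0 <= \int[P]_x (phi x)%:E)%E.
    by apply: integral_ge0 => x _; rewrite lee_fin.
  exists (fine (\int[P]_x (phi x)%:E)); split; first exact: fine_ge0.
  by rewrite fineK// ge0_fin_numE.
have [G [G0 intg]] : exists G : R, 0 <= G /\ (\int[P]_x (g x)%:E = G%:E)%E.
  have h0 : (0 <= \int[P]_x (g x)%:E)%E.
    by apply: integral_ge0 => x _; rewrite lee_fin.
  exists (fine (\int[P]_x (g x)%:E)); split; first exact: fine_ge0.
  by rewrite fineK//; exact: integrable_fin_num.
exists F; split => //; last first.
  move=> x nM i _; apply: contrapT => nF; apply: nM; exists i%:R => -[//|n] _.
  by rewrite leNgt; apply/negP => h; apply: nF; exists n.
apply/eqP; rewrite eq_le measure_ge0 andbT; apply/lee_addgt0Pr => eps eps0.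
rewrite add0e.
(* Chosen so that [A / c <= eps / 2]; the [+ 1] keeps [c] positive when [A = 0]. *)
pose c := 2 * (A + 1) / eps.
have c0 : 0 < c by rewrite divr_gt0// mulr_gt0//; lra.
have [H [mH PH Hsum]] := maximal_inequality hT mphi phi0 c0 phifin.
have {}PH : (P H <= (eps / 2)%:E)%E.
  move: PH; rewrite intphi -(fineK (fin_num_measure P _ mH)) -EFinM !lee_fin.
  move: (fine (P H)) => p; rewrite -ler_pdivlMl// => /le_trans; apply.
  rewrite /c invf_div mulrAC ler_pdivrMr; first nra.
  by rewrite mulr_gt0//; lra.
pose C := 4 * expR 1 * c.
have C0 : 0 <= C by apply: mulr_ge0; [rewrite mulr_ge0// expR_ge0|exact: ltW].
(* Likewise [C * G / lam <= eps / 2]. Since [C] contains [c], [lam] is chosen after [c]. *)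
pose lam := 2 * (C * G + 1) / eps.
have CG0 : 0 <= C * G by rewrite mulr_ge0.
have lam0 : 0 < lam by rewrite divr_gt0// mulr_gt0//; lra.
pose D n := ~` H `&` [set x | lam * n%:R < f (iter n T x) * g (iter (2 * n) T x)].
have mD n : measurable (D n).
  apply: measurableI; first exact: measurableC.
  by apply: measurable_lt_set => //; exact: measurable_cst.
have mUD : measurable (\bigcup_n D n.+1) by exact: bigcup_measurable.
(* The bound from [visits_le] is uniform in [N], so it passes to the infinite series. *)
have PD : (P (\bigcup_n D n.+1) <= (eps / 2)%:E)%E.
  apply: le_trans (generalized_Boole_inequality _ _ _) _ => //.
  apply: lime_le; first exact: is_cvg_nneseries.
  apply: nearW => N.
  have := visits_le N.+1 hT mf mg mH g0 c0 lam0 Hsum.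
  rewrite big_add1 => /le_trans; apply.
  rewrite intg -EFinM lee_fin -/C /lam invf_div mulrAC mulrA.
  rewrite ler_pdivrMr; first nra.
  by rewrite mulr_gt0//; lra.
have FHD : F `<=` H `|` \bigcup_n D n.+1.
  move=> x Fx; have [Hx|nHx] := pselect (H x); [by left|right].
  (* An integer above [lam] turns membership in [F] into one visit beyond the threshold [lam]. *)
  have [n _ /= h] := Fx (Num.truncn lam).+1 I.
  exists n => //; split => //=; rewrite -ltr_pdivlMr//.
  apply: le_lt_trans h; apply: ltW.
  by have /andP[] := truncn_itv (ltW lam0).
apply: le_trans (le_measure _ _ _ FHD) _; rewrite ?inE//; first exact: measurableU.
apply: le_trans (measureU2 _ mH mUD) _.
by rewrite [eps]splitr EFinD leeD.
Qed.
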